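(* Let $m$ and $F$ be positive integers such that $m\geq 3$, $F>2m$ and $m\nmid F$. The map $\varphi:\mathscr L(m,F)\to\mathscr I(m,F)$, $S\mapsto U([S])$, is (well defined and) surjective, and $\varphi(S)=\varphi(S')$ if and only if $\theta(S)=\theta(S')$. In particular, $\varphi$ induces a bijection $\mathscr L(m,F)/\!\sim\;\cong\;\mathscr I(m,F)$.
   Context: $\mathbb N$ denotes the non-negative integers. A numerical semigroup is a submonoid $S$ of $(\mathbb N,+)$ with $\mathbb N\setminus S$ finite. Its multiplicity $\operatorname{m}(S)$ is the smallest positive integer in $S$; its Frobenius number $\operatorname{F}(S)$ is the largest integer not in $S$. A numerical semigroup is irreducible if it cannot be expressed as the intersection of two numerical semigroups properly containing it. $\mathscr L(m,F)$ (respectively $\mathscr I(m,F)$) is the set of all numerical semigroups (respectively all irreducible numerical semigroups) with multiplicity $m$ and Frobenius number $F$. For a numerical semigroup $S$, $\theta(S)=\{s\in S\mid \operatorname{m}(S)<s<\operatorname{F}(S)/2\}$. On $\mathscr L(m,F)$, $S\sim S'$ if and only if $\theta(S)=\theta(S')$, and $[S]=\{S'\in\mathscr L(m,F)\mid S\sim S'\}$. Finally $U([S])=\bigcup_{S'\in[S]}S'$. *)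

(* Defs.v *)
From mathcomp Require Import all_boot all_order all_algebra.
From mathcomp Require Import boolp classical_sets functions cardinality.
Set Implicit Arguments.
Unset Strict Implicit.
Unset Printing Implicit Defensive.
Import Order.TTheory GRing.Theory Num.Theory.
Local Open Scope classical_set_scope.

Definition numerical_semigroup (S : set nat) : Prop :=
  [/\ S 0, (forall x y, S x -> S y -> S (x + y)) & cofinite_set S].

Definition min_of d (T : porderType d) (A : set T) : set T := A `&` lbound A.
Definition max_of d (T : porderType d) (A : set T) : set T := A `&` ubound A.

(* The default values of [xget] in [multiplicity] and [frobenius] are never
   reached on a numerical semigroup: see [multiplicityP] and [frobeniusP]. *)
Definition multiplicity (S : set nat) : nat :=
  xget 0 (min_of [set n | S n /\ 0 < n]).

(* The largest integer (not natural number) outside S; it is -1 for S = N. *)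
Definition frobenius (S : set nat) : int :=
  xget 0%R (max_of (~` (Posz @` S))).

Definition irreducible_semigroup (S : set nat) : Prop :=
  numerical_semigroup S /\
  ~ exists T1 T2 : set nat,
      [/\ numerical_semigroup T1, numerical_semigroup T2,
          S `<` T1, S `<` T2 & S = T1 `&` T2].

Definition semigroups_mF (m F : nat) : set (set nat) :=
  [set S | [/\ numerical_semigroup S, multiplicity S = m & frobenius S = Posz F]].

Definition irreducibles_mF (m F : nat) : set (set nat) :=
  [set S | [/\ irreducible_semigroup S, multiplicity S = m
             & frobenius S = Posz F]].

(* s < F(S) / 2 is written 2 s < F(S), with no rounding. *)
Definition theta (S : set nat) : set nat :=
  [set s | [/\ S s, multiplicity S < s & (2%:Z * s%:Z < frobenius S)%R]].

Definition theta_class (m F : nat) (S : set nat) : set (set nat) :=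
  [set S' | semigroups_mF m F S' /\ theta S = theta S'].

Definition theta_quotient (m F : nat) : set (set (set nat)) :=
  theta_class m F @` semigroups_mF m F.

Definition class_union (C : set (set nat)) : set nat := \bigcup_(S in C) S.

Definition phi (m F : nat) (S : set nat) : set nat :=
  class_union (theta_class m F S).

Lemma multiplicityP (S : set nat) : numerical_semigroup S ->
  min_of [set n | S n /\ 0 < n] (multiplicity S).
Proof.
move=> [_ _ /finite_setP fS]; rewrite /multiplicity.
case: xgetP => [x _ //|noP]; exfalso.
have [n0 [Sn0 n0gt]] : exists n, S n /\ 0 < n.
  apply: contrapT => noS.
  have : infinite_set [set: nat] by exact: infinite_nat.
  apply; apply: (@sub_finite_set _ _ (~` S `|` [set 0])).
    move=> n _; case: n => [|n]; [by right | left => Sn].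
    by apply: noS; exists n.+1.
  by rewrite finite_setU; split=> //; apply/finite_setP.
have ex : exists n, `[< S n /\ 0 < n >] by exists n0; apply/asboolP.
case: (ex_minnP ex) => k /asboolP kP kmin.
apply: (noP k); split=> // j jP.
by rewrite leEnat; apply: kmin; apply/asboolP.
Qed.

Lemma frobeniusP (S : set nat) : numerical_semigroup S ->
  max_of (~` (Posz @` S)) (frobenius S).
Proof.
move=> [_ _ fS]; rewrite /frobenius.
case: xgetP => [x _ //|noP]; exfalso.
have [[n0 Nn0]|allS] := pselect (exists n, ~ S n); last first.
  apply: (noP (-1)%R); split=> [[]//|[n|n] nS //].
  by exfalso; apply: nS; exists n => //; apply: contrapT => Sn; apply: allS; exists n.
have [b bP] : exists b, forall n, ~ S n -> n <= b.
  have /finite_seqP[s sP] := fS.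
  exists (\max_(i <- s) i) => n Sn.
  have ns : n \in s by have : (~` S) n by []; rewrite sP.
  exact: (@leq_bigmax_seq _ s xpredT id).
have ex : exists n, `[< ~ S n >] by exists n0; apply/asboolP.
have ub n : `[< ~ S n >] -> n <= b by move/asboolP; apply: bP.
case: (ex_maxnP ex ub) => k /asboolP kP kmax.
apply: (noP (Posz k)); split=> [[n Sn [nk]]|[n|n] nS //].
  by apply: kP; rewrite -nk.
rewrite lez_nat; apply: kmax; apply/asboolP => Sn.
by apply: nS; exists n.
Qed.

(* Main.v *)
Require Import Defs.
From mathcomp Require Import all_boot all_order all_algebra.
From mathcomp Require Import boolp classical_sets functions cardinality.
From mathcomp Require Import zify.

(** Every semigroup S in L(m,F) lies in
      A(S) = {x in S | x < F/2} U {x > F/2 | F - x is not in S},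
    which is again in L(m,F). The elements of S below F/2 are 0, m and those of
    theta(S), so A(S) depends on theta(S) only and has the same theta; hence it
    is the largest element of [S], that is, U([S]) = A(S).
    Each semigroup properly containing A(S) contains F, so A(S) is irreducible.
    Conversely, an irreducible I equals A(I), for otherwise I would be the
    intersection of A(I) and I U {F}. *)

Import Order.TTheory.
Local Open Scope classical_set_scope.

Lemma max_of_uniq d (T : porderType d) (A : set T) (x y : T) :
  max_of A x -> max_of A y -> x = y.
Proof.
by move=> [Ax ux] [Ay uy]; apply/le_anti/andP; split; [exact: uy|exact: ux].
Qed.

Lemma min_of_uniq d (T : porderType d) (A : set T) (x y : T) :
  min_of A x -> min_of A y -> x = y.
Proof.
by move=> [Ax lx] [Ay ly]; apply/le_anti/andP; split; [exact: lx|exact: ly].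
Qed.

Lemma numerical_semigroup_ub (S : set nat) (F : nat) :
  S 0 -> (forall x y, S x -> S y -> S (x + y)) -> (forall n, F < n -> S n) ->
  numerical_semigroup S.
Proof.
move=> S0 SD SF; split=> //; apply: (@sub_finite_set _ _ `I_F.+1).
  by move=> n nS; rewrite /= ltnS leqNgt; apply/negP => /SF.
exact: finite_II.
Qed.

Lemma multiplicity_eqP (S : set nat) (m : nat) : numerical_semigroup S ->
  0 < m -> multiplicity S = m <-> S m /\ forall x, S x -> x < m -> x = 0.
Proof.
move=> nsS m0; split=> [<-|[Sm mmin]].
  have [[Sm _] lbm] := multiplicityP nsS; split=> // x Sx.
  case: x Sx => // x Sx; have /lbm : S x.+1 /\ 0 < x.+1 by [].
  by rewrite leEnat leqNgt => /negP.
apply: min_of_uniq (multiplicityP nsS) _; split=> // x [Sx x0].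
by rewrite leEnat leqNgt; apply/negP => /(mmin _ Sx) x0'; rewrite x0' in x0.
Qed.

Lemma frobenius_eqP (S : set nat) (F : nat) : numerical_semigroup S ->
  frobenius S = Posz F <-> ~ S F /\ forall n, F < n -> S n.
Proof.
move=> nsS; split=> [frobF|[nSF SF]].
  have [nSF ubF] := frobeniusP nsS; rewrite frobF in nSF ubF.
  split=> [SF|n Fn]; first by apply: nSF; exists F.
  apply: contrapT => nSn; have /ubF : (~` (Posz @` S)) (Posz n).
    by move=> [k Sk [kn]]; apply: nSn; rewrite -kn.
  by rewrite lez_nat leqNgt Fn.
apply: max_of_uniq (frobeniusP nsS) _; split=> [[n Sn [nF]]|[n|//] nSn].
  by apply: nSF; rewrite -nF.
rewrite lez_nat leqNgt; apply/negP => /SF Sn.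
by apply: nSn; exists n.
Qed.

(** Replaces the [xget]-based invariants by elementary conditions on elements, the form used in all
    later arguments. *)
Lemma semigroups_mFP (m F : nat) (S : set nat) : 0 < m ->
  semigroups_mF m F S <->
  [/\ S 0, (forall x y, S x -> S y -> S (x + y)),
      S m /\ (forall x, S x -> x < m -> x = 0), ~ S F
    & forall n, F < n -> S n].
Proof.
move=> m0; split.
  move=> [nsS /(multiplicity_eqP _ _ nsS m0) ? /(frobenius_eqP _ _ nsS)[? ?]].
  by case: nsS.
move=> [S0 SD Sm nSF SF]; have nsS := numerical_semigroup_ub S F S0 SD SF.
split=> //; first exact/multiplicity_eqP.
exact/frobenius_eqP.
Qed.

Lemma thetaE (m F : nat) (S : set nat) : semigroups_mF m F S ->
  theta S = [set s | [/\ S s, m < s & s.*2 < F]].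
Proof.
move=> [_ mS FS]; apply/seteqP; split=> s /=; rewrite /theta /= mS FS;
  by move=> [? ? ?]; split=> //; lia.
Qed.

Definition completion (F : nat) (S : set nat) : set nat :=
  [set x | (x.*2 < F /\ S x) \/ (F < x.*2 /\ ~ (x <= F /\ S (F - x)))].

Section Completion.
Variables m F : nat.
Hypotheses (m_gt0 : 0 < m) (ltmF : m.*2 < F).

(** If x and F - x were both in S, their sum F would be too; in the same way x = F/2 in S would give
    F = x + x. *)
Lemma sub_completion {S : set nat} : semigroups_mF m F S ->
  S `<=` completion F S.
Proof.
move=> /(semigroups_mFP _ _ _ m_gt0)[S0 SD _ nSF _] x Sx.
case: (ltngtP x.*2 F) => xF; first by left.
  right; split=> // -[xleF /(SD _ _ Sx)]; rewrite subnKC //.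
by exfalso; apply: nSF; rewrite -xF -addnn; exact: SD.
Qed.

Lemma completion_mF {S : set nat} : semigroups_mF m F S ->
  semigroups_mF m F (completion F S).
Proof.
move=> mFS; have subC := sub_completion mFS; move: mFS.
move=> /(semigroups_mFP _ _ _ m_gt0)[S0 SD [Sm mmin] nSF SF].
(* The mixed case of closure: were F - (x + y) in S, adding x would put F - y in S. *)
have CD_low x y : S x -> F < y.*2 -> ~ (y <= F /\ S (F - y)) ->
    completion F S (x + y).
  move=> Sx yF nSy; right; split; first lia.
  move=> [xyF /(SD _ _ Sx)]; rewrite (_ : x + _ = F - y); last lia.
  by move=> Sy; apply: nSy; split=> //; lia.
apply/semigroups_mFP => //; split.
- exact: subC.
- move=> x y [[xF Sx]|[xF nSx]] [[yF Sy]|[yF nSy]].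
  + by apply: subC; exact: SD.
  + exact: CD_low.
  + by rewrite addnC; exact: CD_low.
  (* Two elements above F/2 have a sum above F. *)
  + by apply/subC/SF; lia.
- split; first exact: subC.
  (* An element added above F/2 exceeds m because 2m < F. *)
  by move=> x [[_ Sx]|[xF _] xm]; [exact: mmin|lia].
- by move=> [[]|[_]]; [lia|rewrite subnn; apply].
- by move=> n nF; apply/subC/SF.
Qed.

Lemma theta_completion {S : set nat} : semigroups_mF m F S ->
  theta (completion F S) = theta S.
Proof.
move=> mFS; rewrite (thetaE _ _ _ (completion_mF mFS)) (thetaE _ _ _ mFS).
apply/seteqP; split=> s /= [Ss ms sF]; split=> //.
  by case: Ss => [[]//|[]]; lia.
exact: sub_completion.
Qed.

Lemma completion_theta {S S' : set nat} : semigroups_mF m F S ->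
  semigroups_mF m F S' -> theta S = theta S' ->
  completion F S = completion F S'.
Proof.
move=> mFS mFS'; rewrite (thetaE _ _ _ mFS) (thetaE _ _ _ mFS').
move: mFS mFS' => /(semigroups_mFP _ _ _ m_gt0)[S0 _ [Sm mmin] _ _].
move=> /(semigroups_mFP _ _ _ m_gt0)[S'0 _ [S'm m'min] _ _] thetaSS'.
(* Below m both sets contain only 0, both contain m, and above m membership is read off theta. *)
have low x : x.*2 < F -> S x = S' x.
  move=> xF; apply/propext; case: (ltngtP x m) => [xm|xm|-> //].
    by split=> [/mmin|/m'min] ->.
  have /= E := congr1 (@^~ x) thetaSS'.
  split=> Sx.
    by have : [/\ S x, m < x & x.*2 < F] by []; rewrite E => -[].
  by have : [/\ S' x, m < x & x.*2 < F] by []; rewrite -E => -[].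
apply/seteqP; split=> x [[xF Sx]|[xF nSx]]; [left|right|left|right].
- by rewrite -low.
(* For x > F/2 the mirror F - x is below F/2, where [low] applies. *)
- by split=> // -[xleF]; rewrite -low; [move=> ?; apply: nSx|lia].
- by rewrite low.
- by split=> // -[xleF]; rewrite low; [move=> ?; apply: nSx|lia].
Qed.

Lemma phi_completion {S : set nat} : semigroups_mF m F S ->
  phi m F S = completion F S.
Proof.
move=> mFS; apply/seteqP; split=> [x [S' [mFS' thetaSS'] S'x]|x Cx].
  by rewrite (completion_theta mFS mFS' thetaSS'); exact: sub_completion.
exists (completion F S) => //; split; first exact: completion_mF.
by rewrite theta_completion.
Qed.

(** An x in T outside the completion is either F/2, so that F = x + x, or has its mirror F - x in
    the completion, so that F = x + (F - x) is in T. *)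
Lemma frobenius_in_overset {S T : set nat} : numerical_semigroup T ->
  completion F S `<` T -> T F.
Proof.
move=> [_ TD _] [subT /existsNP[x /not_implyP[Tx nCx]]].
case: (ltngtP x.*2 F) => xF; last by rewrite -xF -addnn; exact: TD.
  have CFx : completion F S (F - x).
    right; split; first lia.
    by rewrite subKn; [move=> [_ Sx]; apply: nCx; left|lia].
  by rewrite -(@subnKC x F); [apply: TD => //; exact: subT|lia].
have [xleF SFx] : x <= F /\ S (F - x).
  by apply: contrapT => nSx; apply: nCx; right.
have CFx : completion F S (F - x) by left; split=> //; lia.
by rewrite -(subnKC xleF); apply: TD => //; exact: subT.
Qed.

Lemma completion_irreducible {S : set nat} : semigroups_mF m F S ->
  irreducibles_mF m F (completion F S).
Proof.
move=> mFS; have mFC := completion_mF mFS; have [nsC mC FC] := mFC.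
split=> //; split=> // -[T1 [T2 [ns1 ns2 sub1 sub2 CE]]].
(* F would lie in both [T1] and [T2], hence in the completion, which misses it. *)
have /(semigroups_mFP _ _ _ m_gt0)[_ _ _ + _] := mFC; apply; rewrite CE.
by split; [exact: frobenius_in_overset ns1 sub1|exact: frobenius_in_overset ns2 sub2].
Qed.

Lemma irreducible_completion {S : set nat} : irreducibles_mF m F S ->
  completion F S = S.
Proof.
move=> [[nsS irrS] mS FS]; have mFS : semigroups_mF m F S by [].
have subC := sub_completion mFS; have mFC := completion_mF mFS.
have /(semigroups_mFP _ _ _ m_gt0)[S0 SD _ nSF SF] := mFS.
have /(semigroups_mFP _ _ _ m_gt0)[_ _ _ nCF _] := mFC.
have [nsC _ _] := mFC.
apply: contrapT => CneS; apply: irrS; exists (completion F S), (S `|` [set F]).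
split=> //.
- apply: (numerical_semigroup_ub _ F); first by left.
    (* Adding F to a positive element gives a number above F, hence in S. *)
    have SDF x : S x -> (S `|` [set F]) (F + x).
      by case: x => [|x] Sx; [right; rewrite /= addn0|left; apply: SF; lia].
    move=> x y [Sx|->] [Sy|->]; [by left; exact: SD| | |].
    + by rewrite addnC; exact: SDF.
    + exact: SDF.
    + by left; apply: SF; lia.
  by move=> n /SF; left.
- by split=> // CS; apply: CneS; apply/seteqP; split.
- by split=> [x|/(_ F)]; [left|move=> SF'; apply/nSF/SF'; right].
- apply/seteqP; split=> [x Sx|x [Cx [//|xF]]]; last first.
    by case: nCF; move: xF Cx => ->.
  by split; [exact: subC|left].
Qed.

End Completion.

Theorem corollary9 (m F : nat) (hm : 3 <= m) (hF : 2 * m < F)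
    (hmF : ~~ (m %| F)) :
  [/\ set_fun (semigroups_mF m F) (irreducibles_mF m F) (phi m F),
      set_surj (semigroups_mF m F) (irreducibles_mF m F) (phi m F),
      (forall S S' : set nat, semigroups_mF m F S -> semigroups_mF m F S' ->
        (phi m F S = phi m F S' <-> theta S = theta S'))
    & exists phibar : set (set nat) -> set nat,
        (forall S : set nat, semigroups_mF m F S ->
          phibar (theta_class m F S) = phi m F S) /\
        set_bij (theta_quotient m F) (irreducibles_mF m F) phibar].
Proof.
have m0 : 0 < m by lia.
have mF : m.*2 < F by lia.
have phiE S (mFS : semigroups_mF m F S) := phi_completion m F m0 mF mFS.
have phi_fun : set_fun (semigroups_mF m F) (irreducibles_mF m F) (phi m F).
  by move=> S mFS; rewrite phiE //; exact: completion_irreducible.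
have phi_surj : set_surj (semigroups_mF m F) (irreducibles_mF m F) (phi m F).
  move=> S irrS; have [[nsS _] mS FS] := irrS.
  have mFS : semigroups_mF m F S by [].
  (* An irreducible semigroup is its own preimage. *)
  by exists S => //; rewrite phiE //; exact: (irreducible_completion m).
have phi_theta S S' : semigroups_mF m F S -> semigroups_mF m F S' ->
    phi m F S = phi m F S' <-> theta S = theta S'.
  move=> mFS mFS'; rewrite !phiE //; split; last exact: (completion_theta m).
  (* The completion keeps theta, so theta S can be recovered from the image of S. *)
  by move=> /(congr1 theta); rewrite !(theta_completion m).
(* [phi] is by definition [class_union] after [theta_class], so [class_union] is the induced map. *)
split=> //; exists class_union; split=> //; split.
- by move=> _ [S mFS <-]; exact: phi_fun.
- move=> _ _ /set_mem[S mFS <-] /set_mem[S' mFS' <-] /(phi_theta _ _ mFS mFS').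
  by rewrite /theta_class => ->.
- move=> I /phi_surj[S mFS <-]; exists (theta_class m F S) => //.
  by exists S.
Qed.
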